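(* Let $\tilde r(f,x)$ be the generalized Floater--Hormann interpolant corresponding to fixed parameters $d,\gamma\in\mathbb{N}$ with $\gamma\ge2$, arbitrarily large $n\ge d$, and a distribution of nodes $a=x_0<x_1<\dots<x_n=b$ satisfying $h\sim h^*\sim n^{-1}$. For any $0<\alpha\le1$ and each $s\in\mathbb{N}$ with $s\le d$, if $f\in C^{s,\alpha}([a,b])$ then $$|f(x)-\tilde r(f,x)|\le C\begin{cases}\dfrac1{n^{s+\alpha}}&\text{if }\gamma>s+\alpha+1,\\[2mm]\dfrac{\log n}{n^{s+\alpha}}&\text{if }\gamma=s+\alpha+1,\\[2mm]\dfrac1{n^{\gamma-1}}&\text{if }1<\gamma<s+\alpha+1,\end{cases}\qquad\forall x\in[a,b],$$ where $C>0$ is a constant independent of $n$ and $x$, bounded with respect to $\gamma>1$ but exponentially growing with $d$.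
   Context: $\mathbb{N}=\{1,2,3,\ldots\}$. $C^{s,\alpha}([a,b])$ is the class of functions $f$ that are $s$ times continuously differentiable on $[a,b]$ and whose $s$-th derivative satisfies $|f^{(s)}(x)-f^{(s)}(y)|\le M|x-y|^\alpha$ for all $x,y\in[a,b]$, for some $M>0$. For nodes $a=x_0<\dots<x_n=b$ (depending on $n$), $h=\max_{0\le k<n}(x_{k+1}-x_k)$ and $h^*=\min_{0\le k<n}(x_{k+1}-x_k)$; $u\sim v$ means that the ratio $u/v$ lies between two absolute positive constants (independent of $n$). For $i=0,\ldots,n-d$ let $p_i$ be the unique polynomial of degree $\le d$ interpolating $f$ at $x_i,\ldots,x_{i+d}$, and let $\tilde\lambda_i(x)=(-1)^{i\gamma}\prod_{j=i}^{i+d}(x-x_j)^{-\gamma}$. The generalized Floater--Hormann interpolant of $f$ is $$\tilde r(f,x)=\frac{\sum_{i=0}^{n-d}\tilde\lambda_i(x)p_i(x)}{\sum_{i=0}^{n-d}\tilde\lambda_i(x)},$$ a rational function without real poles, with $\tilde r(f,x_k)=f(x_k)$ at the nodes. The constant $C$ may depend on $f$, $s$, $\alpha$, $[a,b]$ and the constants implicit in $h\sim h^*\sim n^{-1}$.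
   Formalization: In the case γ = s+α+1 the bound with log n is stated only for n ≥ 2, since for n = 1 (d = s = 1, α = 1, γ = 3, f(x) = x²) log n = 0 while the error is nonzero. *)

(* Defs.v *)
From HB Require Import structures.
From mathcomp Require Import all_boot all_order all_algebra.
From mathcomp Require Import all_classical all_reals all_analysis.

Set Implicit Arguments.
Unset Strict Implicit.
Unset Printing Implicit Defensive.

Import Order.TTheory GRing.Theory Num.Theory.
Import numFieldNormedType.Exports.

Local Open Scope classical_set_scope.
Local Open Scope ring_scope.

(* Derivatives are taken relative to [a, b], hence one-sided at a and b; the
   values of f and g outside [a, b] are irrelevant. *)
Definition derivative_on (R : realType) (a b : R) (f g : R -> R) : Prop :=
  forall x : R, x \in `[a, b] ->
    (fun y => (f y - f x) / (y - x)) @ within `[a, b]%classic x^' --> g x.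

(* D k is the k-th derivative of f on [a, b]. *)
Definition Csalpha (R : realType) (s : nat) (alpha a b : R) (f : R -> R) :
    Prop :=
  exists D : nat -> R -> R,
    [/\ D 0%N = f,
        forall k : nat, (k < s)%N -> derivative_on a b (D k) (D k.+1),
        {within `[a, b]%classic, continuous (D s)} &
        exists2 M : R, 0 < M &
          forall x y : R, x \in `[a, b] -> y \in `[a, b] ->
            `|D s x - D s y| <= M * `|x - y| `^ alpha].

(* Nodes are sequences nat -> R of which only x 0, ..., x n matter. *)
Definition nodes (R : realType) (a b : R) (n : nat) (x : nat -> R) : Prop :=
  [/\ x 0%N = a, x n = b & forall k : nat, (k < n)%N -> x k < x k.+1].

Definition mesh (R : realType) (n : nat) (x : nat -> R) : R :=
  \big[Num.max/0]_(k < n) (x k.+1 - x k).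

(* The default value mesh n x is an upper bound of all the gaps, so it does not
   affect the minimum when 0 < n. *)
Definition min_mesh (R : realType) (n : nat) (x : nat -> R) : R :=
  \big[Num.min/mesh n x]_(k < n) (x k.+1 - x k).

(* u ~ v, with the two implicit constants made explicit. *)
Definition equivalent_up_to (R : realType) (c1 c2 u v : R) : Prop :=
  c1 <= u / v <= c2.

Definition interpolates (R : realType) (d i : nat) (x : nat -> R) (f : R -> R)
    (p : {poly R}) : Prop :=
  (size p <= d.+1)%N /\
  forall j : nat, (i <= j <= i + d)%N -> p.[x j] = f (x j).

Definition interp_poly (R : realType) (d i : nat) (x : nat -> R) (f : R -> R) :
    {poly R} :=
  xget 0 [set p | interpolates d i x f p].

Section InterpolationPolynomial.
Variables (R : realType) (d i : nat) (x : nat -> R) (f : R -> R).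
Hypothesis x_inj : {in [pred j | (i <= j <= i + d)%N] &, injective x}.

Lemma interpolates_unique (p q : {poly R}) :
  interpolates d i x f p -> interpolates d i x f q -> p = q.
Proof.
move=> [sp fp] [sq fq]; apply/eqP; rewrite -subr_eq0; apply/eqP.
apply: (@roots_geq_poly_eq0 _ _ [seq x j | j <- iota i d.+1]).
- apply/allP => y /mapP[j]; rewrite mem_iota addnS ltnS => hj ->.
  by rewrite rootE hornerD hornerN fp // fq // subrr.
- rewrite map_inj_in_uniq ?iota_uniq// => j k.
  rewrite !mem_iota !addnS !ltnS => hj hk; exact: x_inj.
- rewrite size_map size_iota (leq_trans (size_polyD _ _))//.
  by rewrite size_polyN geq_max sp sq.
Qed.

Lemma interpolates_exists : exists p, interpolates d i x f p.
Proof.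
pose y (j : 'I_d.+1) := x (i + j)%N.
pose l (j : 'I_d.+1) : {poly R} := \prod_(k | k != j) ('X - (y k)%:P).
have sl j : size (l j) = d.+1.
  rewrite /l -big_filter size_prod_XsubC size_filter -sum1_count.
  by rewrite (sum1_card (predC1 j)) cardC1 card_ord.
have hr (j : 'I_d.+1) : (i + j)%N \in [pred j | (i <= j <= i + d)%N].
  by rewrite inE leq_addr leq_add2l -ltnS ltn_ord.
have lne j : (l j).[y j] != 0.
  rewrite horner_prod; apply/prodf_neq0 => k kj; rewrite hornerXsubC subr_eq0.
  apply: contra kj => /eqP /(x_inj (hr j) (hr k)) /eqP.
  by rewrite eqn_add2l eq_sym.
have l0 j k : k != j -> (l j).[y k] = 0.
  by move=> kj; rewrite horner_prod (bigD1 k)//= hornerXsubC subrr mul0r.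
exists (\sum_j (f (y j) / (l j).[y j]) *: l j); split.
  apply: (leq_trans (size_sum _ _ _)); apply/bigmax_leqP => j _.
  by rewrite (leq_trans (size_scale_leq _ _))// sl.
move=> j /andP[ij jid].
have jd : (j - i < d.+1)%N by rewrite ltnS leq_subLR.
have -> : x j = y (Ordinal jd) by rewrite /y /= subnKC.
rewrite horner_sum (bigD1 (Ordinal jd))//= big1 => [|k kj].
  by rewrite hornerZ addr0 divfK.
have hk : Ordinal jd != k by rewrite eq_sym.
by rewrite hornerZ (l0 _ _ hk) mulr0.
Qed.

Lemma interp_polyP : interpolates d i x f (interp_poly d i x f).
Proof. by have [p hp] := interpolates_exists; apply: (xgetI 0 hp). Qed.

End InterpolationPolynomial.

Definition gfh_weight (R : realType) (d gamma : nat) (x : nat -> R) (i : nat)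
    (t : R) : R :=
  (-1) ^+ (i * gamma) * \prod_(i <= j < (i + d).+1) (t - x j) ^- gamma.

(* At the nodes the displayed quotient has a removable singularity, where the
   interpolant takes the value of f. *)
Definition gfh (R : realType) (n d gamma : nat) (x : nat -> R) (f : R -> R)
    (t : R) : R :=
  if [exists k : 'I_n.+1, t == x k] then f t
  else (\sum_(0 <= i < (n - d).+1)
           gfh_weight d gamma x i t * (interp_poly d i x f).[t])
       / (\sum_(0 <= i < (n - d).+1) gfh_weight d gamma x i t).

(* Main.v *)
(* Let t lie strictly between the nodes x_l and x_{l+1}, write pi_i for the
   product of the |t - x_j| over the i-th window of nodes, so that the i-th
   weight has absolute value pi_i^-gamma.  The weights of all windows with
   l - d <= i <= l + 1 have the same sign; outside this range they either keep
   that sign or alternate, and decrease away from t.  Quasi-uniformity turns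
   this into pi_i^-gamma <= (c + 1) |sum of the weights| for every i.
   Comparing f with its Taylor polynomial at t, Lagrange's formula bounds the
   local error f(t) - p_i(t) by pi_i 2^d / (d! hm^d) times a power of the
   distance to the window.  With k minimizing pi_k, everything reduces to
   bounding sum_i (pi_k / pi_i)^(gamma-1) (m_i + d + 1)^s, where m_i counts the
   nodes between t and the i-th window.  As pi_k <= pi_i, the exponent gamma - 1
   may be lowered to e = 1 or e = 2, which makes the constants independent of
   gamma; and pi_k / pi_i <= c^(d+1) / (m_i binom(m_i + d, d)), where the
   binomial absorbs the power s <= d.  What is left is sum_m 1 / m^e: it is
   bounded for e = 2, allowed when gamma > s + alpha + 1, and at most
   1 + log n for e = 1, which suffices in the two remaining cases. *)
Require Import Defs.
From HB Require Import structures.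
From mathcomp Require Import all_boot all_order all_algebra.
From mathcomp Require Import all_classical all_reals all_analysis.
From mathcomp Require Import ring lra zify.
Import Order.TTheory GRing.Theory Num.Theory.
Import numFieldNormedType.Exports.
Local Open Scope ring_scope.
Set Implicit Arguments.
Unset Strict Implicit.
Unset Printing Implicit Defensive.

(** * Alternating sums, harmonic sums and the logarithm *)

Section ScalarEstimates.
Variable R : realType.

(** Peeling off the first term leaves [sg] times a sum of the same shape; for [sg = -1] the upper
    bound by the first term carries the induction. Both signs occur because [sg] will be
    (-1)^gamma. *)
Lemma alternating_sum_bounds (sg : R) (sg1 : sg = 1 \/ sg = -1) (N : nat)
    (u : nat -> R) :
  (forall m, (m < N)%N -> 0 <= u m) ->
  (forall m, (m.+1 < N)%N -> u m.+1 <= u m) ->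
  0 <= \sum_(0 <= m < N) sg ^+ m * u m /\
  (sg = -1 -> \sum_(0 <= m < N) sg ^+ m * u m <= if N is 0%N then 0 else u 0%N).
Proof.
elim: N u => [|N IH] u u0 ud; first by rewrite big_nil.
have -> : \sum_(0 <= m < N.+1) sg ^+ m * u m =
    u 0%N + sg * \sum_(0 <= m < N) sg ^+ m * u m.+1.
  rewrite big_nat_recl// expr0 mul1r big_distrr/=; congr (_ + _).
  by apply: eq_bigr => m _; rewrite exprS mulrA.
have [S0 SU] := IH (u \o S) (fun m mN => u0 m.+1 mN) (fun m mN => ud m.+1 mN).
have u00 : 0 <= u 0%N by apply: u0.
case: sg1 => sgE; rewrite sgE in S0 SU *.
  by split; [rewrite mul1r addr_ge0|move=> ?; exfalso; lra].
have {}SU := SU erefl.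
rewrite mulN1r; split; last by move=> _; rewrite gerBl.
rewrite subr_ge0; apply: (le_trans SU) => {IH S0 SU}.
by case: N u0 ud => [//|N] _ ud; apply: ud.
Qed.

(** Monotonicity alone would let the first two terms cancel; a first step that shrinks by [kappa]
    leaves at least (1 - kappa) [u 0], and [u 0] is the largest term. *)
Lemma alternating_sum_ge (sg : R) (sg1 : sg = 1 \/ sg = -1) (N : nat)
    (u : nat -> R) (kappa : R) :
  0 <= kappa <= 1 ->
  (forall m, (m < N)%N -> 0 <= u m) ->
  (forall m, (m.+1 < N)%N -> u m.+1 <= u m) ->
  ((1 < N)%N -> u 1%N <= kappa * u 0%N) ->
  forall m, (m < N)%N ->
  (1 - kappa) * u m <= \sum_(0 <= m < N) sg ^+ m * u m.
Proof.
move=> /andP[k0 k1] u0 ud u1 m mN.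
have um0 : u m <= u 0%N.
  elim: m mN => [//|m IH] mN; apply: le_trans (IH (ltnW mN)); exact: ud.
have N0 : (0 < N)%N by apply: leq_ltn_trans mN.
apply: (@le_trans _ _ ((1 - kappa) * u 0%N)).
  by rewrite ler_wpM2l// subr_ge0.
case: N N0 u0 ud u1 {mN} => // N _ u0 ud u1.
have -> : \sum_(0 <= m < N.+1) sg ^+ m * u m =
    u 0%N + sg * \sum_(0 <= m < N) sg ^+ m * u m.+1.
  rewrite big_nat_recl// expr0 mul1r big_distrr/=; congr (_ + _).
  by apply: eq_bigr => i _; rewrite exprS mulrA.
have [S0 SU] := @alternating_sum_bounds sg sg1 N (u \o S)
  (fun m mN => u0 m.+1 mN) (fun m mN => ud m.+1 mN).
have u00 : 0 <= u 0%N by apply: u0.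
have ku0 : 0 <= kappa * u 0%N by apply: mulr_ge0.
rewrite mulrBl mul1r lerD2l.
case: sg1 => sgE; rewrite sgE in S0 SU *.
  by rewrite mul1r; apply: le_trans S0; rewrite oppr_le0.
rewrite mulN1r lerN2; apply: (le_trans (SU erefl)).
by case: N {ud S0 SU} u0 u1 => [//|N] _; apply.
Qed.

(** Induction, with 1/(n+2) <= ln (n+2) - ln (n+1) obtained from ln (1 + y) <= y at y = -1/(n+2). *)
Lemma harmonic_sum_le (n : nat) :
  (1 <= n)%N -> \sum_(0 <= m < n) (m.+1%:R)^-1 <= 1 + ln n%:R :> R.
Proof.
elim: n => [//|[|n] IH] _; first by rewrite big_nat1 ln1 addr0 invr1.
rewrite big_nat_recr//= .
apply: (le_trans (lerD (IH isT) (lexx _))); rewrite -addrA lerD2l.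
have n0 : 0 < n.+1%:R :> R by rewrite ltr0n.
have m0 : 0 < n.+2%:R :> R by rewrite ltr0n.
have E : n.+1%:R / n.+2%:R = 1 + - (n.+2%:R)^-1 :> R.
  rewrite -[n.+2%:R]natr1; move: (n.+1%:R) n0 => z z0; field.
  by rewrite gt_eqF//; lra.
have : ln (n.+1%:R / n.+2%:R) <= - (n.+2%:R)^-1 :> R.
  rewrite E le_ln1Dx// ltrN2 invf_lt1//.
  by rewrite ltr1n.
by rewrite ln_div ?posrE//; move: (ln _) (ln _) (_^-1) => u v w H; lra.
Qed.

Lemma harmonic_square_sum_le (n : nat) :
  \sum_(0 <= m < n) (m.+1%:R ^+ 2)^-1 <= 2 :> R.
Proof.
suff H : \sum_(0 <= m < n.+1) (m.+1%:R ^+ 2)^-1 <= 2 - n.+1%:R^-1 :> R.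
  case: n H => [_|n H]; first by rewrite big_nil.
  apply: (@le_trans _ _ (2 - n.+2%:R^-1)); last first.
    by rewrite gerBl invr_ge0.
  apply: le_trans H; rewrite [leRHS]big_nat_recr//= lerDl invr_ge0.
  exact: exprn_ge0.
elim: n => [|n IH]; first by rewrite big_nat1 expr1n invr1; lra.
rewrite big_nat_recr//=; apply: (le_trans (lerD IH (lexx _))).
have n0 : 0 < n.+1%:R :> R by rewrite ltr0n.
rewrite -[n.+2%:R]natr1; move: (n.+1%:R) n0 => z n0.
have -> : (2 - z^-1 + ((z + 1) ^+ 2)^-1) =
   2 - (z + 1)^-1 - (z * (z + 1) ^+ 2)^-1 :> R.
  field; apply/andP; split; rewrite gt_eqF//; lra.
rewrite gerBl invr_ge0 mulr_ge0// ?exprn_ge0//; lra.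
Qed.

(** This is ln y < y at y = n^alpha; it later trades the logarithm for a power of n. *)
Lemma ln_le_powR_div (n : nat) (alpha : R) : (1 <= n)%N -> 0 < alpha ->
  ln n%:R <= n%:R `^ alpha / alpha.
Proof.
move=> n1 a0; rewrite ler_pdivlMr// mulrC -ln_powR.
have : 0 < n%:R `^ alpha by apply: powR_gt0; rewrite ltr0n.
by move/ln_sublinear/ltW.
Qed.

End ScalarEstimates.

(** * Taylor polynomials with a Hoelder remainder *)

Section TaylorPolynomial.
Variable R : realType.

(** Clearing the denominator brings in the point y = x, which the punctured limit leaves out. *)
Lemma derivative_on_littleo (a b : R) (f g : R -> R) (x e : R) :
  derivative_on a b f g -> x \in `[a, b] -> 0 < e ->
  exists2 del : R, 0 < del & forall y, y \in `[a, b] -> `|y - x| < del ->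
    `|f y - f x - g x * (y - x)| <= e * `|y - x|.
Proof.
move=> dfg xab e0; have /cvgrPdist_le /(_ e e0) := dfg x xab.
rewrite near_withinE => /nbhs_ballP[del /= del0 Hdel].
exists del => // y yab yx.
have [->|ynx] := eqVneq y x; first by rewrite !subrr mulr0 subrr normr0 mulr0.
have yx0 : y - x != 0 by rewrite subr_eq0.
have -> : f y - f x - g x * (y - x) =
    - ((g x - (f y - f x) / (y - x)) * (y - x)) by field.
rewrite normrN normrM ler_wpM2r//.
by apply: Hdel => //=; rewrite /ball /= distrC.
Qed.

Lemma derivative_on_is_derive (a b : R) (f g : R -> R) (x : R) :
  derivative_on a b f g -> x \in `]a, b[ -> is_derive x 1 f (g x).
Proof.
move=> dfg; rewrite in_itv/= => /andP[ax xb].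
have xab : x \in `[a, b] by rewrite in_itv/= !ltW.
have H : (h^-1 *: ((f \o shift x) (h *: 1) - f x) @[h --> 0^'] --> g x)%classic.
  apply/cvgrPdist_le => e e0.
  have [del del0 Hdel] := derivative_on_littleo dfg xab e0.
  near=> h.
  have h0 : h != 0 by near: h; exact: nbhs_dnbhs_neq.
  (* These bounds keep [h + x] inside [a, b], where the first-order estimate is available. *)
  have hm : `|h| < Num.min del (Num.min (x - a) (b - x)).
    near: h; apply: dnbhs0_lt.
    by rewrite !lt_min del0 !subr_gt0 ax xb.
  move: hm; rewrite !lt_min => /and3P[hdel].
  rewrite !ltr_norml => /andP[ha _] /andP[_ hb].
  have /Hdel : h + x \in `[a, b] by rewrite in_itv/=; apply/andP; split; lra.
  rewrite addrK => /(_ hdel) Hh.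
  rewrite /= [h%:A]mulr1 /= -(ler_pM2r (_ : 0 < `|h|)) ?normr_gt0//.
  rewrite -normrM; apply: le_trans Hh; rewrite -normrN le_eqVlt; apply/orP;
    left; apply/eqP; congr (`|_|).
  by rewrite [_ *: _]/GRing.scale/=; field.
by apply: DeriveDef; [apply/cvg_ex; exists (g x)|exact/cvg_lim].
Unshelve. all: end_near. Qed.

Lemma derivative_on_continuous (a b : R) (f g : R -> R) :
  derivative_on a b f g -> {within `[a, b], continuous f}%classic.
Proof.
move=> dfg; apply/subspace_continuousP => x /= xab.
have xab' : x \in `[a, b] by [].
apply/cvgrPdist_le => e e0.
have [del del0 Hdel] := derivative_on_littleo dfg xab' ltr01.
rewrite near_withinE; near=> y => /= yab.
have yd : `|y - x| < del.
  by rewrite distrC; near: y; exact: cvgr_dist_lt.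
have ye : `|y - x| <= e / (1 + `|g x|).
  rewrite distrC; near: y; apply: cvgr_dist_le => //.
  by rewrite divr_gt0// ltr_wpDr.
have g0 : 0 < 1 + `|g x| by rewrite ltr_wpDr.
rewrite ler_pdivlMr// in ye; apply: le_trans ye; rewrite distrC.
have -> : f y - f x = f y - f x - g x * (y - x) + g x * (y - x) by ring.
rewrite (le_trans (ler_normD _ _))// [leRHS]mulrDr lerD//.
  by rewrite mulr1 -[leRHS]mul1r; apply: Hdel.
by rewrite normrM mulrC.
Unshelve. all: end_near. Qed.

(** The mean value theorem applies to f - p: two-sided derivatives exist inside ]x, y[, and the
    one-sided ones supply continuity up to x and y. *)
Lemma derivative_on_mean_value (a b : R) (f g : R -> R) (p : {poly R})
    (x y : R) :
  derivative_on a b f g -> x \in `[a, b] -> y \in `[a, b] -> x < y ->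
  exists2 c, c \in `]x, y[ &
    f y - p.[y] - (f x - p.[x]) = (g c - p^`().[c]) * (y - x).
Proof.
move=> dfg; rewrite !in_itv/= => /andP[ax xb] /andP[ay yb] xy.
have sub : (`[x, y] `<=` `[a, b])%classic.
  by move=> z /=; rewrite !in_itv/= => /andP[xz zy]; apply/andP; split; lra.
apply: (@MVT _ (f \- horner p) (fun z => g z - p^`().[z])) => // [z zxy|].
  apply: is_deriveB; apply: derivative_on_is_derive dfg _.
  by move: zxy; rewrite !in_itv/= => /andP[xz zy]; apply/andP; split; lra.
apply: within_continuousB.
  exact: continuous_subspaceW sub (derivative_on_continuous dfg).
by apply: continuous_subspaceT; exact: continuous_horner.
Qed.

Lemma poly_antiderivative (p : {poly R}) (t v : R) :
  exists q : {poly R}, [/\ (size q <= (size p).+1)%N, q^`() = p & q.[t] = v].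
Proof.
(* At i = 0 the division by zero yields 0, so [q] has no constant term; a constant is added
   afterwards to match the value at t. *)
pose q := \poly_(i < (size p).+1) (p`_i.-1 / i%:R).
have dq : q^`() = p.
  apply/polyP => i; rewrite coef_deriv coef_poly ltnS /=.
  have [ip|ip] := ltnP i (size p).
    by rewrite -[LHS]mulr_natr divfK// pnatr_eq0.
  by rewrite mul0rn nth_default.
exists (q + (v - q.[t])%:P); split.
- rewrite (leq_trans (size_polyD _ _))// geq_max size_poly/=.
  by rewrite (leq_trans (size_polyC_leq1 _)).
- by rewrite derivD derivC addr0.
- by rewrite hornerD hornerC addrC subrK.
Qed.

(** Induction on s: the Taylor polynomial of [D 1] is integrated from t, and the mean value theorem
    turns its error into the error for [D 0], at the price of one more factor |y - t|. *)
Lemma taylor_polynomial (a b alpha M t : R) (s : nat) (D : nat -> R -> R) :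
  0 <= alpha -> 0 <= M ->
  (forall k, (k < s)%N -> derivative_on a b (D k) (D k.+1)) ->
  (forall x y, x \in `[a, b] -> y \in `[a, b] ->
    `|D s x - D s y| <= M * `|x - y| `^ alpha) ->
  t \in `[a, b] ->
  exists p : {poly R}, [/\ (size p <= s.+1)%N, p.[t] = D 0%N t &
    forall y, y \in `[a, b] ->
      `|D 0%N y - p.[y]| <= M * (`|y - t| ^+ s * `|y - t| `^ alpha)].
Proof.
move=> alpha0 M0; elim: s D => [|s IH] D hD hH tab.
  exists (D 0%N t)%:P; split; rewrite ?size_polyC_leq1 ?hornerC// => y yab.
  by rewrite hornerC expr0 mul1r hH.
have [q [sq qt qH]] := IH (fun k => D k.+1) (fun k ks => hD k.+1 ks) hH tab.
have [p [sp dp pt]] := poly_antiderivative q t (D 0%N t).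
exists p; split=> [|//|y yab]; first exact: leq_trans sp _.
suff [c [cab cy E]] : exists c, [/\ c \in `[a, b], `|c - t| <= `|y - t| &
    D 0%N y - p.[y] = (D 1%N c - q.[c]) * (y - t)].
  rewrite E normrM exprSr mulrAC mulrA ler_wpM2r//.
  apply: (le_trans (qH c cab)).
  rewrite ler_wpM2l// ler_pM ?exprn_ge0 ?powR_ge0//.
    by rewrite lerXn2r ?nnegrE.
  by rewrite ge0_ler_powR ?nnegrE.
have H0 := hD 0%N isT.
move: (tab) (yab); rewrite !in_itv/= => /andP[at_ tb] /andP[ay yb].
have [yt|ty|->] := ltgtP y t; last first.
- by exists t; rewrite in_itv/= at_ tb subrr mulr0 pt subrr.
- have [c cty E] := derivative_on_mean_value p H0 tab yab ty.
  exists c; move: cty E; rewrite !in_itv/= => /andP[tc cy].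
  rewrite pt subrr subr0 dp => E; split=> //; first by apply/andP; split; lra.
  by rewrite !ger0_norm; lra.
- have [c cty E] := derivative_on_mean_value p H0 yab tab yt.
  exists c; move: cty E; rewrite !in_itv/= => /andP[yc ct].
  rewrite pt subrr sub0r dp => E; split; first by apply/andP; split; lra.
    by rewrite !ler0_norm; lra.
  by rewrite -[LHS]opprK E -mulrN opprB.
Qed.

End TaylorPolynomial.

(** * Lagrange's formula and the local interpolation error *)

Section InterpolationError.
Variable R : realType.

Lemma lagrange_horner (d : nat) (y : 'I_d.+1 -> R) (p : {poly R}) (t : R) :
  injective y -> (size p <= d.+1)%N ->
  p.[t] = \sum_j p.[y j] * \prod_(k | k != j) ((t - y k) / (y j - y k)).
Proof.
move=> yinj sp.
pose l (j : 'I_d.+1) : {poly R} := \prod_(k | k != j) ('X - (y k)%:P).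
have sl j : size (l j) = d.+1.
  rewrite /l -big_filter size_prod_XsubC size_filter -sum1_count.
  by rewrite (sum1_card (predC1 j)) cardC1 card_ord.
have lE j z : (l j).[z] = \prod_(k | k != j) (z - y k).
  by rewrite horner_prod; apply: eq_bigr => k _; rewrite hornerXsubC.
pose q := \sum_j (p.[y j] / (l j).[y j]) *: l j.
have qy j : q.[y j] = p.[y j].
  rewrite horner_sum (bigD1 j)//= [X in _ + X]big1 ?addr0 => [|k kj].
    rewrite hornerZ divfK// lE; apply/prodf_neq0 => k kj.
    by rewrite subr_eq0 (inj_eq yinj) eq_sym.
  by rewrite hornerZ [(l k).[y j]]lE (bigD1 j) 1?eq_sym//= subrr mul0r mulr0.
have -> : p.[t] = q.[t].
  congr (_.[t]); apply/eqP; rewrite -subr_eq0; apply/eqP.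
  apply: (@roots_geq_poly_eq0 _ _ [seq y j | j <- enum 'I_d.+1]).
  - apply/allP => _ /mapP[j _ ->].
    by rewrite rootE hornerD hornerN subr_eq0 qy.
  - by rewrite map_inj_uniq// enum_uniq.
  - rewrite size_map size_enum_ord (leq_trans (size_polyD _ _))//.
    rewrite size_polyN geq_max sp (leq_trans (size_sum _ _ _))//.
    by apply/bigmax_leqP => j _; rewrite (leq_trans (size_scale_leq _ _))// sl.
rewrite /q horner_sum; apply: eq_bigr => j _.
by rewrite hornerZ !lE prodf_div mulrAC mulrA.
Qed.

(** The factors with k < j multiply to j!, those with k > j to (d - j)!. *)
Lemma prod_distance_ord (d : nat) (j : 'I_d.+1) :
  \prod_(k < d.+1 | k != j) `|j%:R - k%:R| = (j`! * (d - j)`!)%:R :> R.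
Proof.
have fE (m : nat) : m`!%:R = \prod_(0 <= k < m) k.+1%:R :> R.
  by rewrite fact_prod natr_prod big_add1.
rewrite -(big_mkord (fun k => k != j :> nat) (fun k => `|j%:R - k%:R| : R)).
move: (nat_of_ord j) (ltn_ord j) => {}j jd.
have [m dE] : exists m, d = (j + m)%N by exists (d - j)%N; rewrite subnKC.
rewrite {jd}dE addKn -addnS (@big_cat_nat _ _ _ j) ?leq_addr//= natrM;
  congr (_ * _).
  rewrite fE [RHS]big_nat_rev/= big_nat_cond [RHS]big_nat_cond.
  apply: eq_big => k; first by lia.
  move=> /andP[kj _]; rewrite -natrB; last by lia.
  by rewrite ger0_norm//; congr (_%:R); lia.
rewrite big_ltn_cond ?addnS ?ltnS ?leq_addr// eqxx/= fE.
rewrite -{1}[j.+1]add0n -addSn [(j.+1 + m)%N]addnC big_addn addnK.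
apply: eq_big => [k|k _]; first by lia.
by rewrite distrC -natrB; [rewrite ger0_norm//; congr (_%:R); lia|lia].
Qed.

(** Multiplied by d! this is the binomial expansion of (1 + 1)^d. *)
Lemma sum_inv_factorials (d : nat) :
  \sum_(j < d.+1) (j`! * (d - j)`!)%:R^-1 = 2 ^+ d / (d`!)%:R :> R.
Proof.
have -> : 2 ^+ d = \sum_(j < d.+1) ('C(d, j))%:R :> R.
  rewrite -natrX -(_ : 1 + 1 = 2)%N// expnDn natr_sum.
  by apply: eq_bigr => j _; rewrite !exp1n !muln1.
rewrite big_distrl/=; apply: eq_bigr => j _.
have jd : (j <= d)%N by rewrite -ltnS.
have f0 : (j`! * (d - j)`!)%:R != 0 :> R.
  by rewrite pnatr_eq0 -lt0n muln_gt0 !fact_gt0.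
rewrite -(bin_fact jd); move: (j`! * _)%N f0 => F f0.
rewrite natrM invfM mulrA mulfV ?mul1r//.
by rewrite pnatr_eq0 -lt0n bin_gt0.
Qed.

(** Meant for p the interpolant minus the Taylor polynomial. In Lagrange's formula the bound E |t -
    y_j| supplies the factor missing from the j-th numerator, so every term contains the full
    product; the j-th denominator is at least hm^d j! (d - j)!. *)
Lemma interpolation_error (d : nat) (y : 'I_d.+1 -> R) (p : {poly R})
    (t hm E : R) :
  0 < hm -> 0 <= E ->
  (forall j k : 'I_d.+1, hm * `|j%:R - k%:R| <= `|y j - y k|) ->
  (size p <= d.+1)%N ->
  (forall j, `|p.[y j]| <= E * `|t - y j|) ->
  `|p.[t]| <= E * (\prod_j `|t - y j|) * (2 ^+ d / (d`!)%:R / hm ^+ d).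
Proof.
move=> hm0 E0 hy sp hp.
have yinj : injective y.
  move=> j k jk; have := hy j k; rewrite jk subrr normr0.
  rewrite pmulr_rle0// normr_le0 subr_eq0 eqr_nat => /eqP; exact: val_inj.
rewrite (lagrange_horner t yinj sp) -sum_inv_factorials.
rewrite big_distrl/= big_distrr/=.
apply: (le_trans (ler_norm_sum _ _ _)); apply: ler_sum => j _.
rewrite normrM prodf_div normrM normfV !normr_prod.
rewrite [X in _ <= _ * X * _](bigD1 j)//= !mulrA.
rewrite -[leLHS]mulrA -[leRHS]mulrA -invfM.
have f0 : 0 < (j`! * (d - j)`!)%:R :> R.
  by rewrite ltr0n muln_gt0 !fact_gt0.
rewrite mulrA; apply: ler_pM.
- by rewrite mulr_ge0// prodr_ge0.
- by rewrite invr_ge0 prodr_ge0.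
- by rewrite ler_wpM2r// prodr_ge0.
rewrite lef_pV2 ?posrE; last 2 first.
- by rewrite prodr_gt0// => k kj;
  rewrite normr_gt0 subr_eq0 (inj_eq yinj) eq_sym.
- by rewrite mulr_gt0// exprn_gt0.
rewrite -prod_distance_ord mulrC.
have -> : hm ^+ d = \prod_(k < d.+1 | k != j) hm.
  by rewrite prodr_const cardC1 card_ord.
rewrite -big_split/=; apply: ler_prod => k _.
by rewrite hy mulr_ge0// ltW.
Qed.

End InterpolationError.

(** * Factorials, binomials and window products *)

Lemma ffact_ge_exp (m s : nat) : ((m + 1) ^ s <= (m + s) ^_ s)%N.
Proof.
elim: s => [//|s IH].
by rewrite (addnS m s) ffactSS expnS leq_mul//; lia.
Qed.

(** The left side is at most (m+1)...(m+s) = s! C(m+s, s), and C(m+d, d) = C(m+d, m) grows with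
    d. *)
Lemma exp_le_fact_bin (m s d : nat) : (s <= d)%N ->
  (m.+1 ^ s <= s`! * 'C(m + d, d))%N.
Proof.
move=> sd; rewrite -addn1; apply: (leq_trans (ffact_ge_exp m s)).
rewrite -bin_ffact mulnC leq_mul2l; apply/orP; right.
have binC k : 'C(m + k, k) = 'C(m + k, m).
  by rewrite -[RHS]bin_sub ?leq_addr// addKn.
by rewrite !binC leq_bin2l// leq_add2l.
Qed.

(** Here p and q will count the nodes of a window on the two sides of t, so that p + q - 1 = d. *)
Lemma fact_mul_le (p q : nat) : (0 < p)%N -> (0 < q)%N ->
  (p`! * q`! <= (p + q).-1`!)%N.
Proof.
case: p => // p _; case: q => // q _; elim: p => [|p IH].
  by rewrite [X in (X * _)%N]/= mul1n.
rewrite factS -mulnA addSn -pred_Sn;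
  apply: (@leq_trans (p.+2 * (p.+1 + q.+1).-1`!)).
  by rewrite leq_mul2l IH orbT.
by rewrite addSn -pred_Sn factS leq_mul//; lia.
Qed.

(** This is pi_i in the outline above. *)
Definition node_prod (R : realType) (d : nat) (x : nat -> R) (i : nat) (t : R) : R :=
  \prod_(i <= j < (i + d).+1) `|t - x j|.

(** The power g would give kappa^g; it is weakened to kappa so that later constants do not depend on
    gamma. *)
Lemma ler_inv_expr (R : realFieldType) (P Q kappa : R) (g : nat) :
  (0 < g)%N -> 0 < P -> 0 < Q -> 0 <= kappa <= 1 -> P <= kappa * Q ->
  Q ^- g <= kappa * P ^- g.
Proof.
move=> g0 P0 Q0 /andP[k0 k1] PQ.
have H : Q^-1 <= kappa * P^-1 by rewrite ler_pdivlMr// mulrC ler_pdivrMr.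
rewrite -!exprVn; apply: (@le_trans _ _ ((kappa * P^-1) ^+ g)).
  by rewrite lerXn2r// nnegrE ?mulr_ge0 ?invr_ge0// ltW.
rewrite exprMn ler_wpM2r ?exprn_ge0 ?invr_ge0 ?(ltW P0)//.
by case: g g0 => // g _; rewrite exprS ler_piMr// exprn_ile1.
Qed.

(** * Distances from a point to the nodes of a quasi-uniform grid *)

Section Grid.
Variables (R : realType) (n : nat) (x : nat -> R) (hm h c : R).
Hypothesis hm0 : 0 < hm.
Hypothesis gap_ge : forall k, (k < n)%N -> hm <= x k.+1 - x k.
Hypothesis gap_le : forall k, (k < n)%N -> x k.+1 - x k <= h.
Hypothesis h_le : h <= c * hm.

Lemma node_dist_ge i j : (i <= j <= n)%N -> hm * (j - i)%:R <= x j - x i.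
Proof.
elim: j => [|j IH]; first by rewrite leqn0 => /andP[/eqP-> _];
  rewrite mulr0 subrr.
move=> /andP[]; rewrite leq_eqVlt => /predU1P[-> _|].
  by rewrite subnn mulr0 subrr.
rewrite ltnS => ij jn; rewrite subSn// -natr1 mulrDr mulr1.
have -> : x j.+1 - x i = (x j - x i) + (x j.+1 - x j) by ring.
by rewrite lerD ?gap_ge// IH// ij ltnW.
Qed.

Lemma node_dist_le i j : (i <= j <= n)%N -> x j - x i <= h * (j - i)%:R.
Proof.
elim: j => [|j IH]; first by rewrite leqn0 => /andP[/eqP-> _];
  rewrite mulr0 subrr.
move=> /andP[]; rewrite leq_eqVlt => /predU1P[-> _|].
  by rewrite subnn mulr0 subrr.
rewrite ltnS => ij jn; rewrite subSn// -natr1 mulrDr mulr1.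
have -> : x j.+1 - x i = (x j - x i) + (x j.+1 - x j) by ring.
by rewrite lerD ?gap_le// IH// ij ltnW.
Qed.

Variables (l : nat) (t : R).
Hypotheses (ln : (l < n)%N) (xlt : x l < t) (txl : t < x l.+1).

Lemma node_left j : (j <= l)%N -> hm * (l - j)%:R < t - x j.
Proof.
move=> jl; apply: le_lt_trans (_ : x l - x j < _); last by rewrite ltrD2r.
by rewrite node_dist_ge// jl ltnW.
Qed.

Lemma node_right j : (l < j <= n)%N -> hm * (j - l.+1)%:R < x j - t.
Proof.
move=> jl; apply: le_lt_trans (_ : x j - x l.+1 < _);
  last by rewrite ltrD2l ltrN2.
by rewrite node_dist_ge.
Qed.

Lemma node_left_gt0 j : (j <= l)%N -> 0 < t - x j.
Proof. by move=> /node_left; apply: le_lt_trans; rewrite mulr_ge0// ltW. Qed.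

Lemma node_right_gt0 j : (l < j <= n)%N -> 0 < x j - t.
Proof. by move=> /node_right; apply: le_lt_trans; rewrite mulr_ge0// ltW. Qed.

Lemma node_dist_gt0 j : (j <= n)%N -> 0 < `|t - x j|.
Proof.
move=> jn; rewrite normr_gt0; have [jl|lj] := leqP j l.
  by rewrite gt_eqF// node_left_gt0.
by rewrite lt_eqF// -oppr_gt0 opprB node_right_gt0 ?lj.
Qed.

Variable d : nat.

Lemma node_prod_gt0 i : (i + d <= n)%N -> 0 < node_prod d x i t.
Proof.
move=> idn; rewrite /node_prod big_nat_cond prodr_gt0// => j /andP[/andP[_ jd] _].
by apply: node_dist_gt0; rewrite (leq_trans _ idn).
Qed.

(** Consecutive windows differ only in their extreme nodes, so comparing their products reduces to
    comparing two distances. *)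
Lemma node_prod_shift i :
  node_prod d x i.+1 t * `|t - x i| = node_prod d x i t * `|t - x (i + d).+1|.
Proof.
rewrite /node_prod addSn [in LHS]big_nat_recr/=; last by lia.
by rewrite [in RHS]big_ltn; [ring|lia].
Qed.

(** The exponent counts the nodes of the range lying to the right of t; truncated subtraction makes
    it 0 when there are none. *)
Lemma prod_node_sign i k : (i + k <= n.+1)%N ->
  \prod_(i <= j < i + k) (t - x j) =
  (-1) ^+ ((i + k) - maxn i l.+1) * \prod_(i <= j < i + k) `|t - x j|.
Proof.
elim: k => [|k IH] ikn.
  by rewrite addn0 !big_geq// mulr1 (eqP (leq_maxl i l.+1)).
rewrite addnS !big_nat_recr ?leq_addr//= IH; last by lia.
have [kl|lk] := leqP (i + k) l.
  rewrite (gtr0_norm (node_left_gt0 kl)) mulrA.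
  by rewrite (_ : (i + k).+1 - _ = i + k - maxn i l.+1)%N//; lia.
have xk : 0 < x (i + k)%N - t by apply: node_right_gt0; lia.
rewrite distrC (gtr0_norm xk) (_ : (i + k).+1 - _ = (i + k - maxn i l.+1).+1)%N.
  by rewrite exprS; ring.
by lia.
Qed.

(** * Signs and decay of the weights *)

Variable gamma : nat.
Hypothesis gamma0 : (0 < gamma)%N.

Local Notation A i := (node_prod d x i t ^- gamma).

(** The sign exponent is gamma times i plus the number of window nodes right of t. Only the parity
    of that sum matters, so each group of windows may use its own convenient [e]. *)
Lemma gfh_weight_sign i e : (i + d <= n)%N ->
  odd (i + ((i + d).+1 - maxn i l.+1)) = odd e ->
  gfh_weight d gamma x i t = ((-1) ^+ gamma) ^+ e * A i.
Proof.
move=> idn oe; rewrite /gfh_weight prodfV prodrXl.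
rewrite -addnS prod_node_sign ?addnS//.
rewrite exprMn invfM mulrA; congr (_ * _).
have sgV k : ((-1) ^+ k)^-1 = (-1) ^+ k :> R by rewrite -exprVn invrN1.
rewrite -!exprM sgV -exprD -mulnDl [(gamma * e)%N]mulnC 2!exprM.
by rewrite -[in LHS]signr_odd oe signr_odd.
Qed.

Lemma norm_gfh_weight i : (i + d <= n)%N -> `|gfh_weight d gamma x i t| = A i.
Proof.
move=> idn; rewrite (gfh_weight_sign idn erefl) normrM !normrX normrN1 !expr1n mul1r.
by rewrite ger0_norm// invr_ge0 exprn_ge0// ltW// node_prod_gt0.
Qed.

Lemma inv_node_prod_right i kappa : (l < i)%N -> (i.+1 + d <= n)%N ->
  0 <= kappa <= 1 -> x i - t <= kappa * (x (i + d).+1 - t) ->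
  A i.+1 <= kappa * A i.
Proof.
move=> li idn k01 H.
have x0 : 0 < x i - t by apply: node_right_gt0; lia.
have x1 : 0 < x (i + d).+1 - t by apply: node_right_gt0; lia.
have P1 : 0 < node_prod d x i.+1 t by apply: node_prod_gt0; lia.
apply: ler_inv_expr => //; first by apply: node_prod_gt0; lia.
have := node_prod_shift i; rewrite !(distrC t) !gtr0_norm// => E.
by rewrite -(ler_pM2r x1) -E -mulrA mulrCA ler_wpM2l// ltW.
Qed.

Lemma inv_node_prod_left i kappa : (i + d < l)%N ->
  0 <= kappa <= 1 -> t - x (i + d).+1 <= kappa * (t - x i) ->
  A i <= kappa * A i.+1.
Proof.
move=> idl k01 H.
have x0 : 0 < t - x i by apply: node_left_gt0; lia.
have x1 : 0 < t - x (i + d).+1 by apply: node_left_gt0; lia.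
have P0 : 0 < node_prod d x i t by apply: node_prod_gt0; lia.
apply: ler_inv_expr => //; first by apply: node_prod_gt0; lia.
have := node_prod_shift i; rewrite !gtr0_norm// => E.
by rewrite -(ler_pM2r x0) E -mulrA mulrCA ler_wpM2l// ltW.
Qed.

(** * Lower bound for the sum of the weights *)

Hypothesis c1 : 1 <= c.

Let c0 : 0 <= c.
Proof. exact: le_trans c1. Qed.

Hypotheses (d0 : (0 < d)%N) (dn : (d <= n)%N).

Local Notation kappa := (c / (c + 1)).

Lemma kappa_itv : 0 <= kappa <= 1.
Proof.
have c1' : 0 < c + 1 by rewrite ltr_wpDl.
by rewrite divr_ge0 ?(ltW c1')//= ler_pdivrMr// mul1r lerDl.
Qed.

(** The claim amounts to u <= c (v - u), and u <= h <= c hm. *)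
Lemma kappa_gap (u v : R) : u <= h -> hm <= v - u -> u <= kappa * v.
Proof.
move=> uh vu; have c1' : 0 < c + 1 by rewrite ltr_wpDl.
rewrite mulrAC ler_pdivlMr// mulrDr mulr1 [u * c]mulrC -lerBrDl -mulrBr.
by apply: (le_trans uh); apply: (le_trans h_le); rewrite ler_wpM2l.
Qed.

(** Windows i < [p] lie entirely left of t, those from [q] on entirely right, and the ones in
    between have t strictly inside. *)
Let N := (n - d).+1.
Let p := (l.+1 - d)%N.
Let q := minn l.+1 N.

(** All d + 1 nodes of window l + 1 + m exceed t, so its sign exponent has the parity of l + d + m:
    the sum alternates or keeps its sign, starting from the sign common to all three groups. *)
Lemma right_gfh_weight_sum :
  exists2 S : R, \sum_(q <= i < N) gfh_weight d gamma x i t =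
      ((-1) ^+ gamma) ^+ (l + d) * S &
    0 <= S /\ forall i, (q <= i < N)%N -> (1 - kappa) * A i <= S.
Proof.
exists (\sum_(0 <= m < N - q) ((-1) ^+ gamma) ^+ m * A (q + m)).
  rewrite -{1}[q]add0n big_addn big_distrr/= big_nat [RHS]big_nat.
  apply: eq_bigr => m /andP[_ mN].
  rewrite mulrA -exprD [(m + q)%N]addnC; apply: gfh_weight_sign; first lia.
  by lia.
have sg1 : ((-1) ^+ gamma = 1 :> R) \/ ((-1) ^+ gamma = -1 :> R).
  by rewrite -signr_odd; case: (odd gamma); [right|left].
have A0 m : (m < N - q)%N -> 0 <= A (q + m).
  by move=> mN; rewrite invr_ge0 exprn_ge0// ltW// node_prod_gt0//; lia.
have Ad m : (m.+1 < N - q)%N -> A (q + m.+1) <= A (q + m).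
  move=> mN; rewrite addnS -[leRHS]mul1r.
  apply: inv_node_prod_right; rewrite ?lexx ?ler01//; try lia.
  rewrite mul1r lerD2r -subr_ge0.
  apply: le_trans (node_dist_ge (_ : _ <= _ <= n)%N); last by lia.
  by rewrite mulr_ge0// ltW.
split; first by have [] := alternating_sum_bounds sg1 A0 Ad.
move=> i /andP[qi iN]; have -> : i = (q + (i - q))%N by rewrite subnKC.
apply: (@alternating_sum_ge _ _ sg1 _ (fun m => A (q + m))) => //.
- exact: kappa_itv.
(* The first shift exchanges x_(l+1), within h of t, for x_(l+d+2), at least hm farther away. *)
- move=> N1; rewrite addn1 addn0.
  have qE : q = l.+1 by lia.
  apply: inv_node_prod_right; rewrite ?kappa_itv//; try lia.
  apply: kappa_gap.
    rewrite qE; apply: le_trans (gap_le ln).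
    by rewrite lerD2l lerN2 ltW.
  rewrite opprB addrA subrK.
  apply: le_trans (node_dist_ge (_ : _ <= _ <= n)%N); last by lia.
  by rewrite ler_peMr ?(ltW hm0)// ler1n; lia.
- by lia.
Qed.

(** The windows are taken in reverse, nearest to t first. None of their nodes exceeds t, so window l
    - d - m has sign exponent of the parity of l + d + m. *)
Lemma left_gfh_weight_sum :
  exists2 S : R, \sum_(0 <= i < p) gfh_weight d gamma x i t =
      ((-1) ^+ gamma) ^+ (l + d) * S &
    0 <= S /\ forall i, (i < p)%N -> (1 - kappa) * A i <= S.
Proof.
exists (\sum_(0 <= m < p) ((-1) ^+ gamma) ^+ m * A (p - m.+1)).
  rewrite big_nat_rev big_distrr/= big_nat [RHS]big_nat.
  apply: eq_bigr => m /andP[_ mp].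
  by rewrite mulrA -exprD add0n; apply: gfh_weight_sign; lia.
have sg1 : ((-1) ^+ gamma = 1 :> R) \/ ((-1) ^+ gamma = -1 :> R).
  by rewrite -signr_odd; case: (odd gamma); [right|left].
have A0 m : (m < p)%N -> 0 <= A (p - m.+1).
  by move=> mN; rewrite invr_ge0 exprn_ge0// ltW// node_prod_gt0//; lia.
have Ad m : (m.+1 < p)%N -> A (p - m.+2) <= A (p - m.+1).
  move=> mN; have -> : (p - m.+1 = (p - m.+2).+1)%N by lia.
  rewrite -[leRHS]mul1r.
  apply: inv_node_prod_left; rewrite ?lexx ?ler01//; try lia.
  rewrite mul1r lerD2l lerN2 -subr_ge0.
  apply: le_trans (node_dist_ge (_ : _ <= _ <= n)%N); last by lia.
  by rewrite mulr_ge0// ltW.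
split; first by have [] := alternating_sum_bounds sg1 A0 Ad.
move=> i ip; have -> : i = (p - (p - i.+1).+1)%N by lia.
apply: (@alternating_sum_ge _ _ sg1 _ (fun m => A (p - m.+1))) => //.
- exact: kappa_itv.
- move=> N1; have -> : (p - 1 = (p - 2).+1)%N by lia.
  apply: inv_node_prod_left; rewrite ?kappa_itv//; try lia.
  have -> : ((p - 2 + d).+1 = l)%N by lia.
  apply: kappa_gap.
    by apply: le_trans (gap_le ln); rewrite lerD2r ltW.
  rewrite opprB addrC addrA subrK.
  apply: le_trans (node_dist_ge (_ : _ <= _ <= n)%N); last by lia.
  by rewrite ler_peMr ?(ltW hm0)// ler1n; lia.
- by lia.
Qed.

(** Window i has i + d - l nodes right of t, so the exponent 2i + d - l has the parity of l + d
    whatever i is. *)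
Lemma mid_gfh_weight_sum :
  exists2 S : R, \sum_(p <= i < q) gfh_weight d gamma x i t =
      ((-1) ^+ gamma) ^+ (l + d) * S &
    0 <= S /\ forall i, (p <= i < q)%N -> A i <= S.
Proof.
have A0 m : (p <= m < q)%N -> 0 <= A m.
  by move=> mN; rewrite invr_ge0 exprn_ge0// ltW// node_prod_gt0//; lia.
exists (\sum_(p <= i < q) A i).
  rewrite big_distrr/= big_nat [RHS]big_nat; apply: eq_bigr => i ipq.
  by apply: gfh_weight_sign; lia.
rewrite big_nat; split; first exact: sumr_ge0.
move=> i ipq; rewrite -big_nat (@big_cat_nat _ _ _ i)//=; try lia.
rewrite big_nat [X in _ + X]big_ltn; last by lia.
rewrite [X in _ + (_ + X)]big_nat addrCA lerDl addr_ge0// sumr_ge0// => j jpq;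
  by apply: A0; lia.
Qed.

(** The three groups share one sign, hence cannot cancel each other; the constant comes from 1 -
    kappa = 1/(c + 1). *)
Lemma gfh_weight_sum_ge i : (i < N)%N ->
  A i <= (c + 1) * `|\sum_(0 <= i < N) gfh_weight d gamma x i t|.
Proof.
move=> iN; have c1' : 0 < c + 1 by rewrite ltr_wpDl.
have -> : \sum_(0 <= i < N) gfh_weight d gamma x i t =
    \sum_(0 <= i < p) gfh_weight d gamma x i t +
    \sum_(p <= i < q) gfh_weight d gamma x i t +
    \sum_(q <= i < N) gfh_weight d gamma x i t.
  rewrite -addrA -(@big_cat_nat _ _ _ q p)/=; try lia.
  by rewrite -(@big_cat_nat _ _ _ p 0%N)//=; lia.
have [SL -> [SL0 HL]] := left_gfh_weight_sum.
have [SM -> [SM0 HM]] := mid_gfh_weight_sum.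
have [SR -> [SR0 HR]] := right_gfh_weight_sum.
rewrite -!mulrDr normrM !normrX normrN1 !expr1n mul1r.
rewrite ger0_norm ?addr_ge0// mulrC -ler_pdivrMr//.
have kE : 1 - kappa = (c + 1)^-1 by field; rewrite gt_eqF.
rewrite kE in HL HR.
have [ip|pi] := ltnP i p.
  by rewrite mulrC; apply: (le_trans (HL i ip)); rewrite -addrA lerDl addr_ge0.
have [iq|qi] := ltnP i q; last first.
  rewrite mulrC; apply: (le_trans (HR i _)); last by rewrite lerDr addr_ge0.
  by rewrite qi iN.
rewrite ler_pdivrMr//; apply: (le_trans (HM i _)); first by rewrite pi iq.
have S0 : 0 <= SL + SM + SR by rewrite !addr_ge0.
by rewrite mulrDr mulr1; have := mulr_ge0 S0 c0; lra.
Qed.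

(* The number of nodes between t and the i-th window; truncated subtraction
   makes it 0 when t lies within the window. *)
Local Notation mdist i := ((i - l.+1) + (l - (i + d)))%N.

(** * Window products against the distance from t *)

Lemma gap_bound_gt0 : 0 < h.
Proof. by apply: lt_le_trans hm0 _;
  apply: le_trans (gap_ge ln) (gap_le ln). Qed.

Lemma node_dist_window i j : (i <= j <= i + d)%N -> (i + d <= n)%N ->
  `|t - x j| <= (mdist i + d.+1)%:R * h.
Proof.
move=> ij idn; have hle k : (k <= mdist i + d.+1)%N -> h * k%:R <= (mdist i + d.+1)%:R * h.
  by move=> km; rewrite mulrC ler_wpM2r ?ler_nat// ltW// gap_bound_gt0.
have [jl|lj] := leqP j l.
  rewrite (gtr0_norm (node_left_gt0 jl)).
  (* Moving t to the far end of its cell leaves whole gaps to count. *)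
  apply: (@le_trans _ _ (x l.+1 - x j)); first by rewrite lerD2r ltW.
  by apply: (le_trans (node_dist_le _)); [lia|apply: hle; lia].
rewrite distrC gtr0_norm; last by apply: node_right_gt0; lia.
apply: (@le_trans _ _ (x j - x l)); first by rewrite lerD2l lerN2 ltW.
by apply: (le_trans (node_dist_le _)); [lia|apply: hle; lia].
Qed.

(** With m the node distance, the integer factor is m (m+1) ... (m+d), and the nodes of the window,
    from the nearest on, are at least m hm, (m+1) hm, ... away from t. For m = 0 the bound is 0. *)
Lemma node_prod_ge i : (i + d <= n)%N ->
  hm ^+ d.+1 * (d`! * (mdist i * 'C(mdist i + d, d)))%:R <= node_prod d x i t.
Proof.
move=> idn.
have -> : (d`! * (mdist i * 'C(mdist i + d, d)) = (mdist i + d) ^_ d.+1)%N.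
  by rewrite ffactnSr -bin_ffact addnK; ring.
rewrite ffact_prod natr_prod -(big_mkord xpredT (fun r => (mdist i + d - r)%:R)).
have -> : hm ^+ d.+1 = \prod_(0 <= r < d.+1) hm
  by rewrite big_mkord prodr_const card_ord.
rewrite -big_split/=.
have -> : node_prod d x i t = \prod_(0 <= r < d.+1) `|t - x (r + i)%N|.
  by rewrite /node_prod -addnS addnC -{1}[i]add0n big_addn addnK.
have [il|li] := leqP i l.
  have [lid|idl] := leqP l (i + d).
    rewrite (_ : mdist i = 0)%N; last by lia.
    rewrite (bigD1_seq d) ?mem_index_iota ?iota_uniq//= add0n subnn mulr0 mul0r.
    by rewrite prodr_ge0.
  rewrite big_nat [leRHS]big_nat; apply: ler_prod => r rd.
  rewrite mulr_ge0 ?(ltW hm0)//=.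
  rewrite gtr0_norm; last by apply: node_left_gt0; lia.
  apply: le_trans (ltW (node_left _)); last by lia.
  by rewrite ler_pM2l// ler_nat; lia.
rewrite big_nat_rev big_nat [leRHS]big_nat; apply: ler_prod => r rd.
rewrite mulr_ge0 ?(ltW hm0)//=.
rewrite distrC gtr0_norm; last by apply: node_right_gt0; lia.
apply: le_trans (ltW (node_right _)); last by lia.
by rewrite ler_pM2l// ler_nat; lia.
Qed.

(** The [u] nodes left of t are within h, 2h, ..., u h and the [v] nodes right of t likewise; then
    u! v! <= d!. *)
Lemma node_prod_le i : (i <= l < i + d)%N -> (i + d <= n)%N ->
  node_prod d x i t <= h ^+ d.+1 * (d`!)%:R.
Proof.
move=> /andP[il lid] idn.
have fE (m : nat) : m`!%:R = \prod_(0 <= k < m) k.+1%:R :> R.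
  by rewrite fact_prod natr_prod big_add1.
have h0 : 0 <= h by rewrite ltW// gap_bound_gt0.
pose u := (l.+1 - i)%N; pose v := (i + d - l)%N.
have -> : h ^+ d.+1 = h ^+ u * h ^+ v by rewrite -exprD; congr (_ ^+ _);
  rewrite /u /v; lia.
apply: (@le_trans _ _ ((h ^+ u * u`!%:R) * (h ^+ v * v`!%:R))); last first.
  rewrite mulrACA ler_wpM2l ?mulr_ge0 ?exprn_ge0// -natrM ler_nat.
  have -> : d = (u + v).-1 by rewrite /u /v; lia.
  by apply: fact_mul_le; rewrite /u /v; lia.
have hE m : h ^+ m = \prod_(0 <= r < m) h
  by rewrite big_mkord prodr_const card_ord.
rewrite /node_prod (@big_cat_nat _ _ _ l.+1)//=; [|lia..].
apply: ler_pM; rewrite ?prodr_ge0// hE fE -big_split/=.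
  rewrite -{1}[i]add0n big_addn big_nat_rev big_nat [leRHS]big_nat.
  apply: ler_prod => r ru; rewrite normr_ge0/=.
  rewrite gtr0_norm; last by apply: node_left_gt0; rewrite /u in ru *; lia.
  apply: (@le_trans _ _ (x l.+1 - x (0 + u - r.+1 + i)%N)).
    by rewrite lerD2r ltW.
  apply: (le_trans (node_dist_le _)); first by rewrite /u in ru *; lia.
  by rewrite ler_wpM2l// ler_nat /u in ru *; lia.
rewrite -{1}[l.+1]add0n big_addn subSS -/v big_nat [leRHS]big_nat.
apply: ler_prod => r rv; rewrite normr_ge0/= distrC.
rewrite gtr0_norm; last by apply: node_right_gt0; rewrite /v in rv *; lia.
apply: (@le_trans _ _ (x (r + l.+1)%N - x l)).
  by rewrite lerD2l lerN2 ltW.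
apply: (le_trans (node_dist_le _)); first by rewrite /v in rv *; lia.
by rewrite ler_wpM2l// ler_nat; lia.
Qed.

(** On each side of t the node distances are 0, 1, 2, ... without repetition, which costs one [H]
    per side; at most d windows straddle t, each contributing 1 <= [H]. *)
Lemma sum_inv_mdist (e : nat) :
  \sum_(0 <= i < N) ((mdist i).+1%:R ^+ e)^-1 <=
    (d + 2)%:R * \sum_(0 <= m < n) (m.+1%:R ^+ e)^-1 :> R.
Proof.
set H := \sum_(0 <= m < n) _.
have pos k : 0 <= (k.+1%:R ^+ e)^-1 :> R by rewrite invr_ge0 exprn_ge0.
have Hle k : (k <= n)%N -> \sum_(0 <= m < k) (m.+1%:R ^+ e)^-1 <= H.
  move=> kn; rewrite /H (@big_cat_nat _ _ _ k 0%N n)//= lerDl.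
  by rewrite sumr_ge0.
have H1 : 1 <= H.
  apply: le_trans (Hle 1%N _); last by lia.
  by rewrite big_nat1 expr1n invr1.
rewrite (@big_cat_nat _ _ _ p)//=; last by rewrite /p /N; lia.
rewrite (@big_cat_nat _ _ _ q p)//=; [|rewrite /p /q /N; lia..].
have -> : (d + 2)%:R * H = H + (d%:R * H + H) :> R by rewrite natrD; ring.
apply: lerD; last apply: lerD.
- apply: le_trans (Hle p _); last by rewrite /p; lia.
  rewrite big_nat_rev big_nat [leRHS]big_nat ler_sum// => m mp.
  have -> // : (mdist (0 + p - m.+1) = m)%N by move: mp; rewrite /p; lia.
- rewrite big_nat (eq_bigr (fun=> 1)) => [|i ipq]; last first.
    have -> : (mdist i = 0)%N by move: ipq; rewrite /p /q; lia.
    by rewrite expr1n invr1.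
  rewrite -big_nat sumr_const_nat -[leLHS]mulr1; apply: ler_pM => //.
  by rewrite ler_nat /p /q; lia.
- have [qN|Nq] := ltnP q N; last by rewrite big_geq// ltW// (lt_le_trans ltr01).
  apply: le_trans (Hle (N - q)%N _); last by rewrite /q /N; lia.
  rewrite -{1}[q]add0n big_addn big_nat [leRHS]big_nat ler_sum// => m mN.
  have -> // : (mdist (m + q) = m)%N by move: qN mN; rewrite /q /N; lia.
Qed.

Let window_le i : (i < N)%N -> (i + d <= n)%N.
Proof. by rewrite /N; lia. Qed.

(** The minimum is compared with window min(l, n - d), which has t strictly inside. *)
Lemma node_prod_min_le k :
  (forall j, (j < N)%N -> node_prod d x k t <= node_prod d x j t) ->
  node_prod d x k t <= h ^+ d.+1 * (d`!)%:R.
Proof.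
have i0N : (minn l (n - d) < N)%N by rewrite /N; lia.
by move=> kmin; apply: (le_trans (kmin _ i0N)); apply: node_prod_le; lia.
Qed.

(** For m = 0 minimality bounds the ratio by 1. For m > 0 the ratio is at most c^(d+1) / (m B), and
    the rest follows from (m+d+1)^s <= (m+1)^s (d+1)^s, (m+1)^s <= s! B, B <= B^e and m + 1 <=
    2m. *)
Lemma node_prod_ratio i k s e : (i < N)%N -> (k < N)%N -> (s <= d)%N ->
  (0 < e)%N -> (forall j, (j < N)%N -> node_prod d x k t <= node_prod d x j t) ->
  (node_prod d x k t / node_prod d x i t) ^+ e * (mdist i + d.+1)%:R ^+ s <=
  c ^+ (d.+1 * e) * (s`! * d.+1 ^ s * 2 ^ e)%:R * ((mdist i).+1%:R ^+ e)^-1.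
Proof.
move=> iN kN sd e0 kmin.
have idn := window_le iN; have kdn := window_le kN.
have Pi := node_prod_gt0 idn; have Pk := node_prod_gt0 kdn.
have lk := node_prod_min_le kmin.
set rho := _ / _.
have rho0 : 0 <= rho by rewrite divr_ge0// ltW.
have rho1 : rho <= 1 by rewrite ler_pdivrMr// mul1r kmin.
have m1 : 0 < (mdist i).+1%:R ^+ e :> R by rewrite exprn_gt0.
rewrite ler_pdivlMr// exprM.
have cd1 : 1 <= c ^+ d.+1 by rewrite exprn_ege1.
have Kle : ((mdist i + d.+1) ^ s <= (mdist i).+1 ^ s * d.+1 ^ s)%N.
  case: (s) => [//|r].
  by rewrite -expnMn leq_exp2r// mulSn addnC leq_add2l leq_pmulr.
have [m0|m0] := posnP (mdist i).
  rewrite m0 add0n expr1n mulr1.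
  apply: ler_pM; rewrite ?exprn_ge0//.
    by apply: le_trans (exprn_ile1 _ _ _) (exprn_ege1 _ _).
  by rewrite -natrX ler_nat mulnAC leq_pmull// muln_gt0 fact_gt0 expn_gt0.
have rhoE : rho * (mdist i * 'C(mdist i + d, d))%:R <= c ^+ d.+1.
  rewrite mulrAC ler_pdivrMr//.
  apply: le_trans (ler_wpM2l (exprn_ge0 _ c0) (node_prod_ge idn)).
  rewrite (natrM _ d`!) !mulrA -exprMn ler_wpM2r//.
  apply: (le_trans lk);
    rewrite ler_wpM2r// lerXn2r ?nnegrE ?mulr_ge0 ?(ltW hm0)//.
  by rewrite ltW// gap_bound_gt0.
set m := mdist i in m0 m1 Kle rhoE *; set B := 'C(m + d, d) in rhoE *.
have B1 : (0 < B)%N by rewrite bin_gt0 leq_addl.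
apply: (@le_trans _ _ ((rho * (m * B)%:R) ^+ e * (s`! * d.+1 ^ s * 2 ^ e)%:R));
  last first.
  by rewrite ler_wpM2r// lerXn2r// nnegrE ?exprn_ge0// mulr_ge0.
clearbody rho; rewrite exprMn -!mulrA ler_wpM2l ?exprn_ge0// -!natrX -!natrM ler_nat.
apply: (@leq_trans (m.+1 ^ s * d.+1 ^ s * m.+1 ^ e));
  first by rewrite leq_mul2r Kle orbT.
apply: (@leq_trans ((s`! * B) * d.+1 ^ s * (m ^ e * 2 ^ e))).
  apply: leq_mul; first by rewrite leq_mul2r exp_le_fact_bin ?orbT.
  by rewrite -expnMn leq_exp2r// muln2 -addnn -addn1 leq_add2l.
have Be : (B <= B ^ e)%N by rewrite -{1}[B]expn1 leq_pexp2l.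
rewrite expnMn.
have -> : (s`! * B * d.+1 ^ s * (m ^ e * 2 ^ e) = B * (m ^ e * (s`! * d.+1 ^ s * 2 ^ e)))%N.
  by ring.
have -> : (m ^ e * B ^ e * (s`! * d.+1 ^ s * 2 ^ e) =
  B ^ e * (m ^ e * (s`! * d.+1 ^ s * 2 ^ e)))%N by ring.
by rewrite leq_mul2r Be orbT.
Qed.

(** The smoothness order is s + 1 here. One of the s + 1 factors |x_j - t| is reserved for
    Lagrange's formula; the others are bounded through the width of the window. *)
Lemma interp_poly_error (f : R -> R) (P : {poly R}) (M alpha : R) (s i : nat) :
  0 <= M -> 0 <= alpha <= 1 -> (s < d)%N -> (i + d <= n)%N ->
  (size P <= s.+2)%N -> P.[t] = f t ->
  (forall j, (j <= n)%N -> `|f (x j) - P.[x j]| <=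
     M * (`|x j - t| ^+ s.+1 * `|x j - t| `^ alpha)) ->
  `|(interp_poly d i x f).[t] - f t| <=
    M * ((mdist i + d.+1)%:R ^+ s.+1 * (h ^+ s * h `^ alpha)) *
    node_prod d x i t * (2 ^+ d / (d`!)%:R / hm ^+ d).
Proof.
move=> M0 /andP[a0 a1] sd idn sP Pt HP.
have h0 : 0 <= h by rewrite ltW// gap_bound_gt0.
have xinj : {in [pred j | (i <= j <= i + d)%N] &, injective x}.
  move=> j k; rewrite !inE => /andP[ij jd] /andP[ik kd] xjk; apply/eqP.
  apply/negPn/negP; rewrite neq_ltn => /orP[jk|kj].
    have := @node_dist_ge j k; rewrite xjk subrr pmulr_rle0// lern0 subn_eq0.
    by rewrite [(k <= j)%N]leqNgt jk (ltnW jk) (leq_trans kd idn) => /(_ isT).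
  have := @node_dist_ge k j; rewrite xjk subrr pmulr_rle0// lern0 subn_eq0.
  by rewrite [(j <= k)%N]leqNgt kj (ltnW kj) (leq_trans jd idn) => /(_ isT).
have [sp fp] := interp_polyP f xinj.
rewrite -Pt -hornerN -hornerD.
pose y (j : 'I_d.+1) := x (i + j)%N.
have -> : node_prod d x i t = \prod_j `|t - y j|.
  rewrite /node_prod -addnS addnC -{1}[i]add0n big_addn addnK big_mkord.
  by apply: eq_bigr => j _; rewrite addnC.
set K := (mdist i + d.+1)%:R.
have K1 : 1 <= K :> R by rewrite /K ler1n addnS.
apply: (@interpolation_error _ _ y) => //.
- by rewrite !mulr_ge0 ?exprn_ge0 ?powR_ge0.
- move=> j k; wlog jk : j k / (j <= k)%N => [H|].
    have [/H//|/ltnW/H] := leqP j k.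
    by rewrite distrC (distrC (y k)).
  rewrite distrC -natrB// ger0_norm// distrC.
  apply: le_trans (ler_norm _).
  rewrite -(subnDl i); apply: node_dist_ge.
  by rewrite leq_add2l jk (leq_trans _ idn)// leq_add2l -ltnS.
- rewrite (leq_trans (size_polyD _ _))// size_polyN geq_max sp.
  exact: leq_trans sP _.
- move=> j; have jd : (i + j <= i + d)%N by rewrite leq_add2l -ltnS.
  rewrite hornerD hornerN fp; last by rewrite leq_addr.
  have -> : x (i + j)%N = y j by [].
  apply: (le_trans (HP _ (leq_trans jd idn))).
  rewrite -/(y j) (distrC (y j)).
  have wK : `|t - y j| <= K * h by apply: node_dist_window => //;
    rewrite leq_addr.
  move: (`|t - y j|) (normr_ge0 (t - y j)) wK => w w0 wK.
  rewrite exprSr [w ^+ s * w]mulrC -[w * _ * _]mulrA mulrCA [leRHS]mulrC ler_wpM2l//.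
  rewrite ler_wpM2l// exprSr mulrACA.
  have Kh0 : 0 <= K * h by rewrite mulr_ge0.
  apply: ler_pM; rewrite ?exprn_ge0 ?powR_ge0//.
    by rewrite -exprMn lerXn2r// nnegrE.
  apply: (@le_trans _ _ ((K * h) `^ alpha)).
    by rewrite ge0_ler_powR// nnegrE.
  (* K^alpha <= K because K >= 1 and alpha <= 1; this accounts for the integer exponent s + 1 on
     K. *)
  rewrite powRM// ler_wpM2r ?powR_ge0//.
  by rewrite -[leRHS]powRr1// ler_powR.
Qed.

Lemma gfh_error (f : R -> R) (P : {poly R}) (M alpha : R) (s e : nat) :
  0 <= M -> 0 <= alpha <= 1 -> (s < d)%N -> (0 < e < gamma)%N ->
  (size P <= s.+2)%N -> P.[t] = f t ->
  (forall j, (j <= n)%N -> `|f (x j) - P.[x j]| <=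
     M * (`|x j - t| ^+ s.+1 * `|x j - t| `^ alpha)) ->
  `|f t - gfh n d gamma x f t| <=
    (c + 1) * (M * (2 * c) ^+ d * (h ^+ s.+1 * h `^ alpha) *
    (c ^+ (d.+1 * e) * (s.+1`! * d.+1 ^ s.+1 * 2 ^ e)%:R)) *
    ((d + 2)%:R * \sum_(0 <= m < n) (m.+1%:R ^+ e)^-1).
Proof.
move=> M0 a01 sd /andP[e0 eg] sP Pt HP.
have h0 : 0 <= h by rewrite ltW// gap_bound_gt0.
rewrite /gfh ifF; last first.
  apply/negbTE/existsPn => j; rewrite -subr_eq0 -normr_gt0 node_dist_gt0//.
  by rewrite -ltnS.
rewrite -/N; set S := \sum_(0 <= i < N) gfh_weight d gamma x i t.
have [k [kN kmin]] : exists k, (k < N)%N /\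
    forall j, (j < N)%N -> node_prod d x k t <= node_prod d x j t.
  have [k _ kmin] := @arg_minP _ R 'I_N ord0 xpredT
    (fun i => node_prod d x i t) isT.
  by exists k; split=> // j jN; exact: (kmin (Ordinal jN)).
have Pp i : (i < N)%N -> 0 < node_prod d x i t.
  by move=> iN; apply: node_prod_gt0; exact: window_le.
have Pk := Pp k kN.
have lk := node_prod_min_le kmin.
have cp : 0 < c + 1 by rewrite ltr_wpDl.
have Sk : (node_prod d x k t) ^- gamma <= (c + 1) * `|S| := gfh_weight_sum_ge kN.
have S0 : 0 < `|S|.
  by rewrite -(pmulr_rgt0 _ cp); apply: lt_le_trans Sk;
    rewrite invr_gt0 exprn_gt0.
have SV : `|S|^-1 <= (c + 1) * node_prod d x k t ^+ gamma.
  rewrite invf_ple ?posrE// ?mulr_gt0 ?exprn_gt0//.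
  by rewrite invfM ler_pdivrMl.
(* As [S] is the sum of the weights, the error is the weighted mean of the local errors. *)
have -> : f t - (\sum_(0 <= i < N) gfh_weight d gamma x i t *
    (interp_poly d i x f).[t]) / S =
  - ((\sum_(0 <= i < N) gfh_weight d gamma x i t *
    ((interp_poly d i x f).[t] - f t)) / S).
  have -> : \sum_(0 <= i < N) gfh_weight d gamma x i t *
      ((interp_poly d i x f).[t] - f t) =
    (\sum_(0 <= i < N) gfh_weight d gamma x i t * (interp_poly d i x f).[t])
      - S * f t.
    rewrite /S big_distrl/= -sumrB; apply: eq_bigr => i _; exact: mulrBr.
  by field; rewrite -normr_gt0.
rewrite normrN normrM normfV.
apply: (le_trans (ler_wpM2l (normr_ge0 _) SV)).
rewrite mulrCA -[leRHS]mulrA -mulrA ler_wpM2l ?(ltW cp)//.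
apply: (le_trans (ler_wpM2r (exprn_ge0 _ (ltW Pk)) (ler_norm_sum _ _ _))).
apply: (@le_trans _ _ (M * (2 * c) ^+ d * (h ^+ s.+1 * h `^ alpha) *
    (c ^+ (d.+1 * e) * (s.+1`! * d.+1 ^ s.+1 * 2 ^ e)%:R) *
    \sum_(0 <= i < N) ((mdist i).+1%:R ^+ e)^-1)); last first.
  rewrite [leRHS]mulrA ler_wpM2l ?sum_inv_mdist//.
  by rewrite !mulr_ge0 ?exprn_ge0 ?powR_ge0 ?mulr_ge0.
rewrite big_distrl big_distrr/= big_nat [leRHS]big_nat;
  apply: ler_sum => i /= iN.
have Pi := Pp i iN.
have idn := window_le iN.
rewrite normrM norm_gfh_weight//.
have Bi := interp_poly_error M0 a01 sd idn sP Pt HP.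
have Ri := @node_prod_ratio i k s.+1 e iN kN sd e0 kmin.
move: Pi Pk Bi Ri (kmin i iN).
move: lk; move: (node_prod d x k t) (node_prod d x i t) => u v uh v0 u0.
set K := (mdist i + d.+1)%:R; set B := `|_|; set Z := c ^+ (d.+1 * e) * _.
set g := (_ ^+ e)^-1; set ha := h `^ alpha => Bi Ri uv.
have K0 : 0 <= K :> R by [].
have ha0 : 0 <= ha by apply: powR_ge0.
set G := 2 ^+ d / (d`!)%:R / hm ^+ d in Bi.
have G0 : 0 <= G by rewrite !mulr_ge0 ?invr_ge0 ?exprn_ge0// ltW.
(* One factor pi_k remains outside the ratios; its bound h^(d+1) d! cancels the d! of [G] and leaves
   (h / hm)^d <= c^d. *)
have uG : u * G <= h * (2 * c) ^+ d.
  apply: (le_trans (ler_wpM2r G0 uh)).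
  have -> : h ^+ d.+1 * (d`!)%:R * G = h * (2 ^+ d * (h / hm) ^+ d).
    rewrite /G exprS expr_div_n; field.
    by rewrite expf_neq0 ?gt_eqF//= ?ltr0n ?fact_gt0// pnatr_eq0 -lt0n fact_gt0.
  rewrite (exprMn d 2 c) ler_wpM2l// ler_wpM2l ?exprn_ge0// lerXn2r ?nnegrE//.
    by rewrite divr_ge0// ltW.
  by rewrite ler_pdivrMr.
have uv0 : 0 <= u / v by rewrite divr_ge0// ltW.
(* The exponent may be lowered because u / v <= 1 by minimality of u. *)
have uve : (u / v) ^+ gamma.-1 <= (u / v) ^+ e.
  by rewrite ler_wiXn2l// ?ler_pdivrMr ?mul1r// -ltnS prednK.
apply: (@le_trans _ _ (v ^- gamma * (M * (K ^+ s.+1 * (h ^+ s * ha)) * v * G) * u ^+ gamma)).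
  rewrite ler_wpM2r ?exprn_ge0 ?(ltW u0)// ler_wpM2l ?invr_ge0 ?exprn_ge0 ?(ltW v0)//.
have -> : v ^- gamma * (M * (K ^+ s.+1 * (h ^+ s * ha)) * v * G) * u ^+ gamma =
    (M * (h ^+ s * ha)) * ((u * G) * ((u / v) ^+ gamma.-1 * K ^+ s.+1)).
  rewrite -(prednK gamma0)/= !exprS expr_div_n; field.
  by rewrite expf_neq0 ?gt_eqF.
have -> : M * (2 * c) ^+ d * (h ^+ s.+1 * ha) * Z * g =
    (M * (h ^+ s * ha)) * ((h * (2 * c) ^+ d) * (Z * g)).
  by rewrite exprS; ring.
rewrite ler_wpM2l ?mulr_ge0 ?exprn_ge0//.
apply: ler_pM => //; [by rewrite mulr_ge0// ltW|by rewrite mulr_ge0 ?exprn_ge0|].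
by apply: le_trans Ri; rewrite ler_wpM2r// exprn_ge0.
Qed.

End Grid.

(** * From a single cell to the whole interval *)

Lemma node_or_between (R : realType) (n : nat) (x : nat -> R) (t : R) :
  x 0%N <= t <= x n ->
  (exists2 k, (k <= n)%N & t = x k) \/
  exists2 l, (l < n)%N & x l < t < x l.+1.
Proof.
elim: n => [|n IH] /andP[xt tx].
  by left; exists 0%N => //; apply/eqP; rewrite eq_le tx.
have [tn|nt] := leP t (x n).
  have [|[k kn ->]|[l ln lt]] := IH; first by rewrite xt.
    by left; exists k => //; rewrite (leq_trans kn).
  by right; exists l => //; rewrite ltnS ltnW.
move: tx; rewrite le_eqVlt => /predU1P[->|tx]; first by left; exists n.+1.
by right; exists n => //; rewrite nt.
Qed.

Lemma min_mesh_gt0 (R : realType) (a b : R) (n : nat) (x : nat -> R) :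
  (0 < n)%N -> nodes a b n x -> 0 < min_mesh n x.
Proof.
move=> n0 [_ _ xx]; apply: lt_bigmin => [|i _]; last by rewrite subr_gt0 xx.
apply: lt_le_trans (le_bigmax _ _ (Ordinal n0)).
by rewrite subr_gt0 xx.
Qed.

Lemma nodes_itv (R : realType) (a b : R) (n : nat) (x : nat -> R) (j : nat) :
  nodes a b n x -> (j <= n)%N -> x j \in `[a, b].
Proof.
move=> [<- <- xx] jn; rewrite in_itv/=; apply/andP; split.
  elim: j jn => [//|j IH] jn; apply: le_trans (IH (ltnW jn)) _.
  exact/ltW/xx.
move: xx jn; elim: n => [|n IH] xx; first by rewrite leqn0 => /eqP ->.
rewrite leq_eqVlt => /predU1P[->//|jn].
by apply: le_trans (IH _ jn) _ => [k kn|]; [apply: xx;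
  rewrite ltnS ltnW|exact/ltW/xx].
Qed.

(** The bounds on [mesh] and [min_mesh] combine to h <= c^2 / n. Every constant depending on d is
    collected into one d-th power. *)
Lemma gfh_rate (R : realType) (a b alpha c M : R) (s : nat) (f : R -> R) :
  0 < alpha <= 1 -> 1 <= c -> 0 <= M ->
  (forall t, t \in `[a, b] -> exists p : {poly R},
    [/\ (size p <= s.+2)%N, p.[t] = f t & forall y, y \in `[a, b] ->
      `|f y - p.[y]| <= M * (`|y - t| ^+ s.+1 * `|y - t| `^ alpha)]) ->
  forall (d gamma n e : nat) (x : nat -> R),
    (s < d)%N -> (d <= n)%N -> (0 < e < gamma)%N -> (e <= 2)%N ->
    nodes a b n x -> mesh n x <= c * min_mesh n x -> min_mesh n x <= c / n%:R ->
  forall t, t \in `[a, b] ->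
  `|f t - gfh n d gamma x f t| <=
    (c + 1) * M * ((c ^+ 2) ^+ s.+1 * (c ^+ 2) `^ alpha) * c ^+ 2 *
      (s.+1`! * 8)%:R *
    ((2 * c) * c ^+ 2 * 2 ^+ s.+2) ^+ d *
    ((n%:R `^ (s.+1%:R + alpha))^-1 * \sum_(0 <= m < n) (m.+1%:R ^+ e)^-1).
Proof.
move=> /andP[a0 a1] c1 M0 HP d gamma n e x sd dn /andP[e0 eg] e2 xn hc hn t tab.
have c0 : 0 <= c by apply: le_trans c1.
have d0 : (0 < d)%N by apply: leq_trans sd.
have n0 : (0 < n)%N by apply: leq_trans dn.
have nR0 : 0 < n%:R :> R by rewrite ltr0n.
set W := (_ `^ _)^-1; set Hs := \sum_(_ <= _ < _) _.
have W0 : 0 <= W by rewrite invr_ge0 powR_ge0.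
have Hs0 : 0 <= Hs by rewrite sumr_ge0// => i _; rewrite invr_ge0 exprn_ge0.
set q := 2 * c * _ * _; set C := (c + 1) * _ * _ * _ * _.
have p2 : 0 <= 2 ^+ s.+2 :> R by apply: exprn_ge0.
have q0 : 0 <= q by apply: mulr_ge0 p2; rewrite !mulr_ge0 ?exprn_ge0.
have C0 : 0 <= C.
  by rewrite /C !mulr_ge0 ?exprn_ge0 ?powR_ge0// addr_ge0.
have hm0 := min_mesh_gt0 n0 xn.
have [x0 xN xx] := xn.
have [|[k kn tk]|[l ln /andP[xlt txl]]] := @node_or_between _ n x t.
- by rewrite x0 xN; move: tab; rewrite in_itv.
(* At a node the error vanishes, so nonnegativity of the bound suffices. *)
- rewrite /gfh ifT ?subrr ?normr0; last first.
    by apply/existsP; exists (inord k); rewrite inordK ?ltnS// tk.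
  by apply: mulr_ge0; apply: mulr_ge0 => //; exact: exprn_ge0.
have [p [sp pt Hp]] := HP t tab.
apply: (le_trans (@gfh_error _ n x (min_mesh n x) (mesh n x) c hm0 _ _ hc l t
  ln xlt txl d gamma _ c1 d0 dn f p M alpha s e M0 _ sd _ sp pt _)).
- by move=> k kn; exact: (bigmin_le _ (Ordinal kn)).
- by move=> k kn; exact: (le_bigmax _ _ (Ordinal kn)).
- exact: leq_ltn_trans eg.
- by rewrite (ltW a0).
- by rewrite e0.
- by move=> j jn; apply: Hp; exact: nodes_itv xn jn.
set h := mesh n x; rewrite -/Hs.
have h0 : 0 <= h.
  apply: le_trans (le_bigmax _ _ (Ordinal n0)).
  by rewrite subr_ge0 ltW// xx.
have hle : h <= c ^+ 2 / n%:R.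
  by apply: (le_trans hc); rewrite expr2 -mulrA ler_wpM2l.
have E1 : h ^+ s.+1 * h `^ alpha <= (c ^+ 2) ^+ s.+1 * (c ^+ 2) `^ alpha * W.
  have -> : W = (n%:R^-1) ^+ s.+1 * (n%:R^-1) `^ alpha.
    rewrite /W powRD ?powR_mulrn ?(ltW nR0) ?pnatr_eq0 -?lt0n ?n0 ?implybT//.
    by rewrite invfM exprVn -[in RHS](powR_inv1 (ltW nR0)) -powRrM mulN1r powRN.
  rewrite mulrACA -exprMn -powRM ?exprn_ge0 ?invr_ge0//.
  apply: ler_pM; rewrite ?exprn_ge0 ?powR_ge0//.
    by rewrite lerXn2r ?nnegrE// (le_trans h0).
  by rewrite ge0_ler_powR ?nnegrE ?(ltW a0)// (le_trans h0).
have E2 : c ^+ (d.+1 * e) <= c ^+ 2 * (c ^+ 2) ^+ d.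
  by rewrite -exprS -exprM mulnC ler_weXn2l// leq_mul2r e2 orbT.
(* Polynomial factors in d become exponential: d + 1 <= 2^d and d + 2 <= 2 * 2^d; the 8 is this 2
   times 2^e <= 4. *)
have E3 : (s.+1`! * d.+1 ^ s.+1 * 2 ^ e)%:R * (d + 2)%:R <=
    (s.+1`! * 8)%:R * (2 ^+ s.+2) ^+ d :> R.
  rewrite -natrM -!natrX -natrM ler_nat.
  have d2 : (d.+1 <= 2 ^ d)%N by exact: ltn_expl.
  have -> : (s.+1`! * 8 * (2 ^ s.+2) ^ d =
     s.+1`! * (2 ^ d) ^ s.+1 * 2 ^ 2 * (2 ^ d * 2))%N.
    by rewrite -expnM [(s.+2 * d)%N]mulnC expnM [(_ ^ s.+2)%N]expnS; ring.
  apply: leq_mul; last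
    by rewrite muln2 -addnn addn2 -addn1 leq_add// (leq_trans _ d2).
  apply: leq_mul; last by rewrite leq_exp2l.
  by rewrite leq_mul2l leq_exp2r// d2 orbT.
have -> : (c + 1) * (M * (2 * c) ^+ d * (h ^+ s.+1 * h `^ alpha) *
    (c ^+ (d.+1 * e) * (s.+1`! * d.+1 ^ s.+1 * 2 ^ e)%:R)) *
    ((d + 2)%:R * Hs) =
  (c + 1) * M * (2 * c) ^+ d * Hs * ((h ^+ s.+1 * h `^ alpha) *
    (c ^+ (d.+1 * e) * ((s.+1`! * d.+1 ^ s.+1 * 2 ^ e)%:R * (d + 2)%:R))).
  by move: (h ^+ s.+1 * _) (c ^+ (d.+1 * e)) ((_ * _)%:R) => u v w; ring.
have -> : C * q ^+ d * (W * Hs) = (c + 1) * M * (2 * c) ^+ d * Hs *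
   (((c ^+ 2) ^+ s.+1 * (c ^+ 2) `^ alpha * W) *
   ((c ^+ 2 * (c ^+ 2) ^+ d) * ((s.+1`! * 8)%:R * (2 ^+ s.+2) ^+ d))).
  rewrite /C /q [(_ * 2 ^+ s.+2) ^+ d]exprMn (exprMn d (2 * c) (c ^+ 2)).
  move: ((c ^+ 2) ^+ s.+1 * _) ((c ^+ 2) ^+ d) ((_ * _)%:R) ((2 ^+ s.+2) ^+ d) => u v w z.
  by ring.
rewrite ler_wpM2l//; first by rewrite !mulr_ge0 ?exprn_ge0 ?mulr_ge0// addr_ge0.
apply: ler_pM => //; first by rewrite mulr_ge0 ?exprn_ge0 ?powR_ge0.
  by rewrite !mulr_ge0 ?exprn_ge0.
by apply: ler_pM => //; rewrite ?exprn_ge0 ?mulr_ge0.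
Qed.


(** * Uniform constants and the three ranges of gamma *)

Theorem theorem5p4 (R : realType) (a b : R) (hab : a < b)
    (alpha : R) (halpha0 : 0 < alpha) (halpha1 : alpha <= 1)
    (s : nat) (hs : (1 <= s)%N)
    (f : R -> R) (hf : Csalpha s alpha a b f)
    (c1 c2 : R) (hc1 : 0 < c1) (hc2 : 0 < c2) :
  exists C0 q : R, 0 < C0 /\ 1 < q /\
    forall (d gamma n : nat) (x : nat -> R),
      (1 <= d)%N -> (2 <= gamma)%N -> (s <= d)%N -> (d <= n)%N ->
      nodes a b n x ->
      equivalent_up_to c1 c2 (mesh n x) (min_mesh n x) ->
      equivalent_up_to c1 c2 (min_mesh n x) (n%:R)^-1 ->
      forall t : R, t \in `[a, b] ->
        (s%:R + alpha + 1 < gamma%:R ->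
          `|f t - gfh n d gamma x f t|
            <= C0 * q ^+ d * (1 / n%:R `^ (s%:R + alpha))) /\
        (gamma%:R = s%:R + alpha + 1 -> (2 <= n)%N ->
          `|f t - gfh n d gamma x f t|
            <= C0 * q ^+ d * (ln n%:R / n%:R `^ (s%:R + alpha))) /\
        (1 < gamma%:R :> R -> gamma%:R < s%:R + alpha + 1 ->
          `|f t - gfh n d gamma x f t|
            <= C0 * q ^+ d * (1 / n%:R ^+ (gamma - 1))).
Proof.
case: hf => D [D0 dD _ [M M0 HD]].
(* A single constant bounding both mesh ratios; the maximum secures [1 <= c]. *)
pose c := Num.max 1 c2.
have c1' : 1 <= c by rewrite le_max lexx.
have c2c : c2 <= c by rewrite le_max lexx orbT.
have [s' sE] : exists s', s = s'.+1 by exists s.-1; rewrite prednK.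
have HP t : t \in `[a, b] -> exists p : {poly R},
    [/\ (size p <= s'.+2)%N, p.[t] = f t & forall y, y \in `[a, b] ->
      `|f y - p.[y]| <= M * (`|y - t| ^+ s'.+1 * `|y - t| `^ alpha)].
  by rewrite -D0 -sE; exact: (taylor_polynomial (ltW halpha0) (ltW M0) dD HD).
set C := (c + 1) * M * ((c ^+ 2) ^+ s * (c ^+ 2) `^ alpha) * c ^+ 2 *
  (s`! * 8)%:R.
set q := (2 * c) * c ^+ 2 * 2 ^+ s.+1.
have ln2 : 0 < ln 2 :> R by rewrite ln_gt0// ltr1n.
(* The 2 bounds the sum of inverse squares, 1/ln 2 turns the 1 of 1 + ln n into a multiple of ln n
   for n >= 2, and 1/alpha comes from ln n <= n^alpha / alpha. *)
pose K := 2 + (ln 2)^-1 + alpha^-1 : R.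
have c0 : 0 < c by apply: lt_le_trans c1'.
have cc0 : 0 < c ^+ 2 by apply: exprn_gt0.
have C0 : 0 < C.
  rewrite /C; apply: mulr_gt0; last by rewrite ltr0n muln_gt0 fact_gt0.
  apply: mulr_gt0 => //; apply: mulr_gt0; first by apply: mulr_gt0 => //; lra.
  by apply: mulr_gt0; [exact: exprn_gt0|exact: powR_gt0].
have i2 : 0 < (ln 2)^-1 :> R by rewrite invr_gt0.
have ia : 0 < alpha^-1 by rewrite invr_gt0.
have K0 : 0 < K by rewrite /K; lra.
exists (C * K), q; split; first exact: mulr_gt0.
have q1 : 1 < q.
  rewrite /q; apply: (@lt_le_trans _ _ (2 * 1 * 1 * 1)); first by lra.
  have c21 : 1 <= c ^+ 2 by apply: exprn_ege1.
  have s21 : 1 <= 2 ^+ s.+1 :> R by apply: exprn_ege1; lra.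
  by do 3! apply: ler_pM => //.
split=> // d gamma n x d1 g2 sd dn xn hE hmE t tab.
have n0 : (0 < n)%N by apply: leq_trans dn.
have nR : 1 <= n%:R :> R by rewrite ler1n.
have nR0 : 0 < n%:R :> R by rewrite ltr0n.
have hm0 := min_mesh_gt0 n0 xn.
have hc : mesh n x <= c * min_mesh n x.
  case/andP: hE => _; rewrite ler_pdivrMr// => /le_trans; apply.
  by rewrite ler_pM2r.
have hn : min_mesh n x <= c / n%:R.
  case/andP: hmE => _; rewrite ler_pdivrMr ?invr_gt0// => /le_trans; apply.
  by rewrite ler_pM2r ?invr_gt0.
have rate e : (0 < e < gamma)%N -> (e <= 2)%N ->
    `|f t - gfh n d gamma x f t| <= C * q ^+ d *
      ((n%:R `^ (s%:R + alpha))^-1 * \sum_(0 <= m < n) (m.+1%:R ^+ e)^-1).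
  move=> eg e2; rewrite /C /q sE; rewrite sE in sd.
  by apply: (gfh_rate _ c1' (ltW M0) HP sd dn eg e2 xn hc hn tab);
    rewrite halpha0.
have Cq0 : 0 <= C * q ^+ d.
  by apply: mulr_ge0; [exact: ltW|apply: exprn_ge0; lra].
clearbody C q.
have assoc B : C * K * q ^+ d * B = C * q ^+ d * (K * B).
  by rewrite -!mulrA; congr (_ * _); rewrite mulrCA.
have W0 : 0 < n%:R `^ (s%:R + alpha) by apply: powR_gt0.
have H1 : \sum_(0 <= m < n) (m.+1%:R ^+ 1)^-1 <= 1 + ln n%:R :> R.
  exact: harmonic_sum_le.
have bound B : (\sum_(0 <= m < n) (m.+1%:R ^+ 1)^-1) / n%:R `^ (s%:R + alpha) <= K * B ->
    `|f t - gfh n d gamma x f t| <= C * K * q ^+ d * B.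
  move=> HB; apply: (le_trans (rate 1%N _ _)) => //.
  by rewrite assoc ler_wpM2l// mulrC.
split; [|split].
(* Since s >= 1 and alpha > 0, gamma exceeds 2, so e = 2 is admissible. *)
- move=> sg; have g3 : (2 < gamma)%N.
    rewrite -(ltr_nat R); apply: le_lt_trans sg.
    have : 1 <= s%:R :> R by rewrite ler1n.
    by lra.
  apply: (le_trans (rate 2%N _ _)) => //.
  rewrite assoc ler_wpM2l// mul1r mulrC ler_wpM2r ?invr_ge0 ?(ltW W0)//.
  by apply: (le_trans (harmonic_square_sum_le R n)); rewrite /K; lra.
- move=> _ n2; apply: bound; rewrite mulrA ler_wpM2r ?invr_ge0 ?(ltW W0)//.
  apply: (le_trans H1).
  have l2n : ln 2 <= ln n%:R :> R by rewrite ler_ln ?posrE// ler_nat.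
  have : 1 <= (ln 2)^-1 * ln n%:R :> R by rewrite mulrC ler_pdivlMr// mul1r.
  have : 0 <= alpha^-1 * ln n%:R
    by rewrite mulr_ge0 ?(ltW ia)// (le_trans (ltW ln2)).
  by rewrite /K !mulrDl; lra.
(* From alpha <= 1 one gets gamma < s + 2, and gamma is an integer. *)
- move=> _ gs; have gs' : (gamma - 1 <= s)%N.
    rewrite leq_subLR -ltnS -(ltr_nat R); apply: (lt_le_trans gs).
    by rewrite -natr1 natrD; lra.
  apply: bound.
  rewrite powRD ?powR_mulrn ?(ltW nR0) ?pnatr_eq0 -?lt0n ?n0 ?implybT//.
  have na : 1 <= n%:R `^ alpha by rewrite -[leLHS](powRr0 n%:R) ler_powR// ltW.
  (* The factor n^alpha of the denominator pays for the logarithm, leaving n^-s <= n^-(gamma-1). *)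
  have Kn : \sum_(0 <= m < n) (m.+1%:R ^+ 1)^-1 <= K * n%:R `^ alpha.
    apply: (le_trans H1); have L := ln_le_powR_div n0 halpha0.
    have : 0 <= (ln 2)^-1 * n%:R `^ alpha :> R
      by rewrite mulr_ge0 ?(ltW i2)// powR_ge0.
    by rewrite /K !mulrDl [alpha^-1 * _]mulrC; lra.
  have na0 : 0 < n%:R `^ alpha by apply: lt_le_trans na.
  have ns0 : 0 < n%:R ^+ s :> R by apply: exprn_gt0.
  apply: (@le_trans _ _ (K * n%:R `^ alpha / (n%:R ^+ s * n%:R `^ alpha))).
    by rewrite ler_wpM2r// invr_ge0 ltW// mulr_gt0.
  have -> : K * n%:R `^ alpha / (n%:R ^+ s * n%:R `^ alpha) = K / n%:R ^+ s.
    by field; rewrite !gt_eqF.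
  rewrite mul1r ler_wpM2l ?(ltW K0)// lef_pV2 ?posrE ?exprn_gt0//.
  by rewrite ler_weXn2l.
Qed.
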